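(* Let $\widetilde P$ and $P$ be stochastic matrices indexed by $\{0,\dots,k\}$. Assume that there exist two coprime positive integers $n_1$ and $n_2$ such that $$\widetilde P^{\,n_1}\unlhd P^{\,n_1}\quad\text{and}\quad \widetilde P^{\,n_2}\unlhd P^{\,n_2}.$$ Then $\widetilde P^{\,n}\unlhd P^{\,n}$ for every integer $n\ge\hat n(n_1,n_2)$.
   Context: For probability distributions $\mu,\nu$ on $\{0,\dots,k\}$, $\mu\preceq_{st}\nu$ means $\sum_{l=j}^k\mu_l\le\sum_{l=j}^k\nu_l$ for every $j=0,\dots,k$. For stochastic matrices $A=(a_{i,j})_{i,j=0,\dots,k}$ and $A'=(a'_{i,j})_{i,j=0,\dots,k}$, write $A'\unlhd A$ if and only if $a'_{i,\cdot}\preceq_{st}a_{j,\cdot}$ for all $0\le i\le j\le k$, where $a_{j,\cdot}$ is the $j$-th row of $A$ and $a'_{i,\cdot}$ the $i$-th row of $A'$. With $\mathbb N=\{0,1,2,\dots\}$, $$\hat n(n_1,n_2)=\inf\{r\in\mathbb N:\ \text{every integer } r'\ge r \text{ can be written as } r'=an_1+bn_2 \text{ with } a,b\in\mathbb N\}.$$ *)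

(* Defs.v *)
From HB Require Import structures.
From mathcomp Require Import all_boot all_order all_algebra.
From mathcomp Require Import classical_sets reals.

Set Implicit Arguments.
Unset Strict Implicit.
Unset Printing Implicit Defensive.

Import Order.TTheory GRing.Theory Num.Theory.
Local Open Scope ring_scope.

Definition stochastic (R : realType) (k : nat) (A : 'M[R]_k.+1) : Prop :=
  (forall i j, 0 <= A i j) /\ (forall i, \sum_j A i j = 1).

Definition st_le (R : realType) (k : nat) (mu nu : 'rV[R]_k.+1) : Prop :=
  forall j : 'I_k.+1,
    \sum_(l < k.+1 | (j <= l)%N) mu 0 l <= \sum_(l < k.+1 | (j <= l)%N) nu 0 l.

(* The two row indices range independently over i <= j: this compares all such
   rows, not only rows of equal index, so the relation is not reflexive. *)
Definition row_st_le (R : realType) (k : nat) (A' A : 'M[R]_k.+1) : Prop :=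
  forall i j : 'I_k.+1, (i <= j)%N -> st_le (row i A') (row j A).

Notation "mu ⪯st nu" := (st_le mu nu) (at level 70, no associativity).
Notation "A' ⊴ A" := (row_st_le A' A) (at level 70, no associativity).

(* The default value 0 of infimum is only reached when the set is empty, which
   does not happen for coprime positive n1 and n2. *)
Definition nhat (n1 n2 : nat) : nat :=
  infimum 0%N
    [set r : nat | forall r' : nat, (r <= r')%N ->
       exists a b : nat, r' = (a * n1 + b * n2)%N]%classic.

(* Main.v *)
Require Import Defs.
From HB Require Import structures.
From mathcomp Require Import all_boot all_order all_algebra.
From mathcomp Require Import classical_sets reals.
From mathcomp Require Import boolp.
Import Order.TTheory GRing.Theory Num.Theory.
Local Open Scope ring_scope.

(** The relation [⊴] is compatible with products: the tail sums of the rows of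
    [B'] and [B] are separated by a nondecreasing function (the running maximum
    of the tail sums of [B']), and integrating a nondecreasing function is
    monotone for the stochastic order, by summation by parts. Since the identity satisfies [1 ⊴ 1], the
    set of exponents [n] with [Pt ^+ n ⊴ P ^+ n] is a submonoid of the naturals,
    and it contains [n1] and [n2]. *)

(** By well-ordering [A] has a least element; it is an infimum, and infima are unique, so [infimum]
    must select it. *)
Lemma infimum_nat_mem (x0 : nat) (A : set nat) :
  (A !=set0 -> A (infimum x0 A))%classic.
Proof.
move=> A0; rewrite /infimum (introF eqP); last by apply/eqP/set0P.
case: A0 => x Ax.
have exA : exists n, `[< A n >] by exists x; apply/asboolP.
case: (ex_minnP exA) => m /asboolP Am minm.
have infm : infimums A m.
  split=> [y Ay|y lby]; last exact: lby.
  by rewrite leEnat; apply/minm/asboolP.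
case: xgetP => [y -> infy|/(_ m)//].
by rewrite (is_subset1_infimums infy infm).
Qed.

Lemma coprime_representable (n1 n2 n : nat) :
    (0 < n1)%N -> (0 < n2)%N -> coprime n1 n2 -> (n1 * n2 <= n)%N ->
  exists a b : nat, n = (a * n1 + b * n2)%N.
Proof.
move=> n1_gt0 n2_gt0 co12 le_n.
(* Chinese remaindering: [c] is congruent to [n] modulo [n1] and to 0 modulo [n2], so [n - c] and
   [c] are the two multiples sought. *)
pose c := (chinese n1 n2 n 0 %% (n1 * n2))%N.
have c_le_n : (c <= n)%N.
  by apply: leq_trans le_n; apply/ltnW; rewrite ltn_mod muln_gt0 n1_gt0.
have /dvdnP[a def_a] : (n1 %| n - c)%N.
  rewrite -eqn_mod_dvd // modn_dvdm ?dvdn_mulr //.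
  by rewrite chinese_modl.
have /dvdnP[b def_b] : (n2 %| c)%N.
  by rewrite /dvdn modn_dvdm ?dvdn_mull // chinese_modr // mod0n.
by exists a, b; rewrite -def_a -def_b subnK.
Qed.

Lemma nhat_representable (n1 n2 n : nat) :
    (0 < n1)%N -> (0 < n2)%N -> coprime n1 n2 -> (nhat n1 n2 <= n)%N ->
  exists a b : nat, n = (a * n1 + b * n2)%N.
Proof.
move=> n1_gt0 n2_gt0 co12; move: n.
have := infimum_nat_mem 0 [set r : nat | forall r' : nat, (r <= r')%N ->
  exists a b : nat, r' = (a * n1 + b * n2)%N]%classic.
(* The product is a crude bound; it only shows that the set is nonempty. *)
by apply; exists (n1 * n2)%N => r; apply: coprime_representable.
Qed.

Section StochasticOrder.
Context {R : realType} {k : nat}.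
Implicit Types (mu nu : 'rV[R]_k.+1) (A B : 'M[R]_k.+1).

(** Extending [h] by 0 before index 0 makes sums of increments telescope to [h l] with no boundary
    term. The price is the condition [0 <= h 0] in [st_le_sum]. *)
Definition increment (h : nat -> R) (j : nat) : R :=
  if j is j'.+1 then h j - h j' else h 0%N.

Lemma sum_increment (h : nat -> R) (l : 'I_k.+1) :
  \sum_(j < k.+1 | (j <= l)%N) increment h j = h l.
Proof.
transitivity (\sum_(j < l.+1) increment h j).
  by rewrite (big_ord_widen _ (increment h) (ltn_ord l)).
elim: (l : nat) => [|n IHn]; first by rewrite big_ord1.
by rewrite big_ord_recr /= IHn addrC subrK.
Qed.

Lemma sum_tails mu (h : nat -> R) :
  \sum_l mu 0 l * h l =
  \sum_(j < k.+1) increment h j * \sum_(l < k.+1 | (j <= l)%N) mu 0 l.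
Proof.
under eq_bigr => l _ do rewrite -sum_increment mulr_sumr.
rewrite (exchange_big_dep xpredT) //=; apply: eq_bigr => j _.
by rewrite mulr_sumr; apply: eq_bigr => l _; rewrite mulrC.
Qed.

Lemma st_le_sum mu nu (h : nat -> R) :
    0 <= h 0%N -> {homo h : m n / (m <= n)%N >-> m <= n} -> mu ⪯st nu ->
  \sum_l mu 0 l * h l <= \sum_l nu 0 l * h l.
Proof.
move=> h0 homo_h le_mu_nu; rewrite !sum_tails; apply: ler_sum => j _.
apply: ler_wpM2l (le_mu_nu j).
by case: (nat_of_ord j) => //= i; rewrite subr_ge0 homo_h.
Qed.

Lemma tail_mulmx A B (i j : 'I_k.+1) :
  \sum_(m < k.+1 | (j <= m)%N) row i (A * B) 0 m =
  \sum_l row i A 0 l * \sum_(m < k.+1 | (j <= m)%N) row l B 0 m.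
Proof.
under eq_bigr => m _ do rewrite mxE [(A * B) i m]mxE.
rewrite exchange_big /=; apply: eq_bigr => l _.
by rewrite mulr_sumr; apply: eq_bigr => m _; rewrite !mxE.
Qed.

Lemma row_st_le_mul A' A B' B :
    (forall i j, 0 <= A' i j) -> (forall i j, 0 <= A i j) ->
    (forall i j, 0 <= B i j) ->
  A' ⊴ A -> B' ⊴ B -> A' * B' ⊴ A * B.
Proof.
move=> A'0 A0 B0 leA leB i j le_ij t; rewrite !tail_mulmx.
pose tail C (l : 'I_k.+1) : R := \sum_(m < k.+1 | (t <= m)%N) row l C 0 m.
(* Tails of [B'] need not be monotone in the row index, hence the maximum. Its default 0 gives
   [0 <= h 0] and is harmless in [h_le_tail], as tails of [B] are nonnegative. *)
pose h n : R := \big[Num.max/0]_(m < k.+1 | (m <= n)%N) tail B' m.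
have homo_h : {homo h : m n / (m <= n)%N >-> m <= n}.
  by move=> m n le_mn; apply: sub_bigmax => l /leq_trans -> //.
have tail_le_h (l : 'I_k.+1) : tail B' l <= h l.
  exact: (le_bigmax_cond _ (tail B') (leqnn l)).
(* Here [⊴] is needed for all pairs [m <= l], not only for equal rows. *)
have h_le_tail (l : 'I_k.+1) : h l <= tail B l.
  apply: bigmax_le => [|m le_ml]; last exact: leB.
  by apply: sumr_ge0 => m _; rewrite mxE.
apply: (@le_trans _ _ (\sum_l row i A' 0 l * h l)).
  by apply: ler_sum => l _; apply: ler_wpM2l (tail_le_h l); rewrite mxE.
apply: (@le_trans _ _ (\sum_l row j A 0 l * h l)).
  exact: st_le_sum (bigmax_ge_id _ _ _ _) homo_h (leA _ _ le_ij).
by apply: ler_sum => l _; apply: ler_wpM2l (h_le_tail l); rewrite mxE.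
Qed.

Lemma row_st_le1 : (1 : 'M[R]_k.+1) ⊴ 1.
Proof.
have tail1 (i t : 'I_k.+1) :
    \sum_(l < k.+1 | (t <= l)%N) row i (1 : 'M[R]_k.+1) 0 l = (t <= i)%:R.
  rewrite big_mkcond /= (bigD1 i) //= big1 => [|l ne_li].
    by rewrite !mxE eqxx addr0; case: leqP.
  by rewrite !mxE eq_sym (negPf ne_li) if_same.
(* The tail of row [i] is the indicator of [t <= i], nondecreasing in [i]. *)
move=> i j le_ij t; rewrite !tail1 ler_nat.
by case: (leqP t i) => // /leq_trans->.
Qed.

Lemma exprmx_ge0 A (n : nat) :
  (forall i j, 0 <= A i j) -> forall i j, 0 <= (A ^+ n) i j.
Proof.
move=> A0; elim: n => [|n IHn] i j; first by rewrite expr0 mxE ler0n.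
by rewrite exprS mxE; apply: sumr_ge0 => l _; apply: mulr_ge0.
Qed.

End StochasticOrder.

Theorem theorem5 (R : realType) (k : nat) (Pt P : 'M[R]_k.+1)
    (hPt : stochastic Pt) (hP : stochastic P)
    (n1 n2 : nat) (hn1 : (0 < n1)%N) (hn2 : (0 < n2)%N)
    (hcop : coprime n1 n2)
    (h1 : Pt ^+ n1 ⊴ P ^+ n1) (h2 : Pt ^+ n2 ⊴ P ^+ n2) :
  forall n : nat, (nhat n1 n2 <= n)%N -> Pt ^+ n ⊴ P ^+ n.
Proof.
case: hPt hP => [Pt0 _] [P0 _] n /(nhat_representable _ _ _ hn1 hn2 hcop)[a [b ->]].
have leD m m' : Pt ^+ m ⊴ P ^+ m -> Pt ^+ m' ⊴ P ^+ m' ->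
    Pt ^+ (m + m') ⊴ P ^+ (m + m').
  by rewrite !exprD; apply: row_st_le_mul; apply: exprmx_ge0.
have leM m c : Pt ^+ m ⊴ P ^+ m -> Pt ^+ (c * m) ⊴ P ^+ (c * m).
  (* The case [c = 0] covers representations with a zero coefficient. *)
  move=> le_m; elim: c => [|c IHc]; first exact: row_st_le1.
  by rewrite mulSn; apply: leD.
by apply: leD; apply: leM.
Qed.
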